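(* Let $G$ be a compact Hausdorff topological group, $(I,\leq)$ a directed set and $\{G_i;p_i^j;I\}$ an inverse system of Hausdorff topological groups with $G=\varprojlim G_i$ and projections $p_i:G\to G_i$ ($i\in I$). Let $H_i=\ker(p_i)$. Let $\eta$ be a continuous partial action of $G$ on a Hausdorff space $X$ such that $G*X$ is closed in $G\times X$. Put $X_i=X/\!\sim_{H_i}$, and let $\varprojlim X_i$ be the limit of the inverse system $\{X_i,\pi_i^j,I\}$, with projections $\varphi_i:\varprojlim X_i\to X_i$. Then: (i) there is a partial action $\theta$ of $G$ on $\varprojlim X_i$ such that $X$ is $G$-equivalent to $\varprojlim X_i$; and (ii) for this $\theta$ and every $j\in I$, the map $\mathrm{id}_G\times\varphi_j$ sends $G*\varprojlim X_i$ into $G*X_j$, and $$\varphi_j\circ\theta=\eta^{p_{H_j}}\circ(\mathrm{id}_G\times\varphi_j)\quad\text{on } G*\varprojlim X_i,$$ where $\eta^{p_{H_j}}:G*X_j\to X_j$ is the partial action of $G$ on $X_j$ described in the context.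
   Context: A partial action of a topological group $G$ on a space $X$ is a function $\eta:G*X\to X$ with domain $G*X\subseteq G\times X$, written $g\cdot x=\eta(g,x)$, where ''$\exists g\cdot x$'' means $(g,x)\in G*X$, such that for all $g,h\in G$, $x\in X$: (PA1) if $\exists g\cdot x$ then $\exists g^{-1}\cdot(g\cdot x)$ and $g^{-1}\cdot(g\cdot x)=x$; (PA2) if $\exists g\cdot(h\cdot x)$ (in particular $\exists h\cdot x$) then $\exists (gh)\cdot x$ and $g\cdot(h\cdot x)=(gh)\cdot x$; (PA3) $\exists 1\cdot x$ and $1\cdot x=x$. Put $X_g=\{x\in X\mid \exists g^{-1}\cdot x\}$ and let $\eta_g:X_{g^{-1}}\to X_g$, $x\mapsto g\cdot x$, which is a bijection. All partial actions are assumed topological: every $X_g$ is open in $X$ and every $\eta_g$ is a homeomorphism. The partial action is continuous if $\eta:G*X\to X$ is continuous, where $G*X$ has the subspace topology from the product $G\times X$. For a subgroup $H$ of $G$, $\{\eta_h\}_{h\in H}$ is a partial action of $H$ on $X$; its orbit relation is $x\sim_H y$ iff there is $h\in H$ with $\exists h\cdot x$ and $h\cdot x=y$. The orbit space $X/\!\sim_H$ has the quotient topology and $\pi_H:X\to X/\!\sim_H$ is the quotient map. For subgroups $H_1\subseteq H_2$, $\pi_{H_1,H_2}:X/\!\sim_{H_1}\to X/\!\sim_{H_2}$ is the unique map with $\pi_{H_2}=\pi_{H_1,H_2}\circ\pi_{H_1}$. For $i\le j$ in $I$ one has $p_i^j\circ p_j=p_i$, so $H_j\subseteq H_i$; the bonding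 map is $\pi_i^j=\pi_{H_j,H_i}:X_j\to X_i$. For a normal subgroup $H$ of $G$, there is a partial action $\eta_{G/H}$ of $G/H$ on $X/\!\sim_H$ with domain $\{(gH,\pi_H(x)) : \text{there is } h\in H \text{ with } (hg,x)\in G*X\}$ and $\eta_{G/H}(gH,\pi_H(x))=\pi_H((hg)\cdot x)$ for any $h\in H$ with $(hg,x)\in G*X$. The partial action $\eta^{p_H}$ of $G$ on $X/\!\sim_H$ is its pullback along $p_H:G\to G/H$: its domain is $G*(X/\!\sim_H)=\{(g,\pi_H(x)) : (gH,\pi_H(x))\in G/H*(X/\!\sim_H)\}$ and $\eta^{p_H}(g,\pi_H(x))=\eta_{G/H}(gH,\pi_H(x))$. If $G$ acts partially on $A$ and $B$ (by $\alpha$, $\beta$), a function $\epsilon:A\to B$ is a $G$-map if $(g,a)\in G*A$ implies $(g,\epsilon(a))\in G*B$ and $\epsilon(\alpha(g,a))=\beta(g,\epsilon(a))$; $A$ is $G$-equivalent to $B$ if there is a $G$-map $A\to B$ that is a homeomorphism. *)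

(* Defs.v *)
From HB Require Import structures.
From mathcomp Require Import all_boot all_order.
From mathcomp Require Import all_classical.
From mathcomp Require Import topology.

Set Implicit Arguments.
Unset Strict Implicit.
Unset Printing Implicit Defensive.

Local Open Scope quotient_scope.
Local Open Scope classical_set_scope.
Local Open Scope group_scope.

(* For maps between subsets, the subsets are seen as types through [set_type],
   which carries the subspace topology. *)
Definition homeomorphism (X Y : topologicalType) (f : X -> Y) :=
  continuous f /\
  exists g : Y -> X, [/\ cancel f g, cancel g f & continuous g].

HB.mixin Record Group_Topological_isTopologicalGroup G
    & Group G & Topological G := {
  mulg_continuous : continuous (fun xy : G * G => xy.1 * xy.2);
  invg_continuous : continuous (fun x : G => x^-1)
}.

#[short(type="topologicalGroupType")]
HB.structure Definition TopologicalGroup :=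
  {G of Group G & Topological G & Group_Topological_isTopologicalGroup G}.

Section InverseSystems.
Context {d : Order.disp_t} {I : preorderType d}.

Definition directed :=
  [set: I] !=set0 /\ forall i j : I, exists k, (i <= k)%O && (j <= k)%O.

Variables (T : I -> topologicalType)
  (f : forall i j, (i <= j)%O -> T j -> T i).

Definition inverse_system :=
  [/\ forall i j (ij : (i <= j)%O), continuous (f ij),
      forall i (ii : (i <= i)%O) x, f ii x = x &
      forall i j k (ij : (i <= j)%O) (jk : (j <= k)%O) (ik : (i <= k)%O) x,
        f ij (f jk x) = f ik x].

Definition inverse_limit : set (prod_topology T) :=
  [set x | forall i j (ij : (i <= j)%O), f ij (x j) = x i].

Definition inverse_limit_proj j (x : inverse_limit) : T j := val x j.

Section Cone.
Variables (L : topologicalType) (p : forall i, L -> T i).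

Definition cone := forall i j (ij : (i <= j)%O) x, f ij (p j x) = p i x.

Lemma cone_map_subproof (pC : cone) x : (fun i => p i x) \in inverse_limit.
Proof. by apply/mem_set => i j ij; exact: pC. Qed.

Definition cone_map (pC : cone) (x : L) : inverse_limit :=
  exist _ (fun i => p i x) (cone_map_subproof pC x).

(* For groups with multiplicative [f] and [p], [cone_map] is then also a group
   isomorphism, since it is multiplicative coordinatewise. *)
Definition is_inverse_limit := exists pC : cone, homeomorphism (cone_map pC).

End Cone.

End InverseSystems.

Arguments directed {d} I.
Arguments inverse_system {d I} T f.
Arguments is_inverse_limit {d I} T f L p.
Arguments inverse_limit_proj {d I T f} j x.

(* [pact] is a total function; only its values on [pact_dom], the set G*X on
   which the partial action is defined, are meaningful. *)
Record partial_action (G : groupType) (X : Type) := PartialAction {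
  pact_dom : set (G * X);
  pact :> G * X -> X;
  pact_inv : forall g x, pact_dom (g, x) ->
    pact_dom (g^-1, pact (g, x)) /\ pact (g^-1, pact (g, x)) = x;
  pact_mul : forall g h x, pact_dom (h, x) -> pact_dom (g, pact (h, x)) ->
    pact_dom (g * h, x) /\ pact (g, pact (h, x)) = pact (g * h, x);
  pact_one : forall x, pact_dom (1, x) /\ pact (1, x) = x
}.

Section TopologicalPartialActions.
Variables (G : groupType) (X : topologicalType) (eta : partial_action G X).

Definition pact_set (g : G) : set X := [set x | pact_dom eta (g^-1, x)].

Lemma pact_map_subproof g (x : pact_set g^-1) : eta (g, val x) \in pact_set g.
Proof.
by apply/mem_set/(pact_inv _).1; case: x => x /= /set_mem;
  rewrite /pact_set /= invgK.
Qed.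

Definition pact_map g (x : pact_set g^-1) : pact_set g :=
  exist _ (eta (g, val x)) (pact_map_subproof x).

Definition topological_pact :=
  forall g, open (pact_set g) /\ homeomorphism (@pact_map g).

End TopologicalPartialActions.

Definition continuous_pact (G : topologicalGroupType) (X : topologicalType)
    (eta : partial_action G X) :=
  {within pact_dom eta, continuous eta}.

Section GMaps.
Variables (G : groupType) (A B : topologicalType).
Variables (alpha : partial_action G A) (beta : partial_action G B).

Definition is_Gmap (eps : A -> B) := forall g a, pact_dom alpha (g, a) ->
  pact_dom beta (g, eps a) /\ eps (alpha (g, a)) = beta (g, eps a).

Definition G_equivalent := exists2 eps : A -> B, is_Gmap eps & homeomorphism eps.

End GMaps.

Section MultiplicativeTheory.
Variables (G K : groupType) (f : {multiplicative G -> K}).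

Lemma multiplicative1 : f 1 = 1.
Proof. by apply: (mulgI (f 1)); rewrite -gmulfM !mulg1. Qed.

Lemma multiplicativeV g : f g^-1 = (f g)^-1.
Proof. by apply: (mulgI (f g)); rewrite -gmulfM !mulgV multiplicative1. Qed.

End MultiplicativeTheory.

Section Pullback.
Variables (G K : groupType) (X : Type) (f : {multiplicative G -> K}).
Variable beta : partial_action K X.

Program Definition pullback_pact : partial_action G X :=
  @PartialAction G X [set gx | pact_dom beta (f gx.1, gx.2)]
    (fun gx => beta (f gx.1, gx.2)) _ _ _.
Next Obligation. by move=> g x /= gx; rewrite multiplicativeV; exact: pact_inv. Qed.
Next Obligation. by move=> g h x /= hx ghx; rewrite gmulfM; exact: pact_mul. Qed.
Next Obligation. by move=> x /=; rewrite multiplicative1; exact: pact_one. Qed.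

End Pullback.

Record normal_subgroup (G : groupType) := NormalSubgroup {
  normal_subgroup_closed :> groupClosed G;
  normal_subgroupJ : forall g h,
    h \in normal_subgroup_closed -> h ^ g \in normal_subgroup_closed
}.

Section Kernel.
Variables (G K : groupType) (f : {multiplicative G -> K}).

Definition ker_pred : {pred G} := [pred g | f g == 1].

Let ker_predM : mulg_closed ker_pred.
Proof.
by move=> g h; rewrite !inE gmulfM => /eqP-> /eqP->; rewrite mulg1.
Qed.

Let ker_pred1 : 1 \in ker_pred.
Proof. by rewrite inE multiplicative1. Qed.

Let ker_predV : invg_closed ker_pred.
Proof. by move=> g; rewrite !inE multiplicativeV invg_eq1. Qed.

HB.instance Definition _ := isMulClosed.Build G ker_pred ker_predM.
HB.instance Definition _ := isMul1Closed.Build G ker_pred ker_pred1.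
HB.instance Definition _ := isInvClosed.Build G ker_pred ker_predV.

Lemma ker_predJ g h : h \in ker_pred -> h ^ g \in ker_pred.
Proof.
rewrite !inE conjgE !gmulfM => /eqP->.
by rewrite mul1g multiplicativeV mulVg.
Qed.

Definition hom_ker : normal_subgroup G := NormalSubgroup ker_predJ.

End Kernel.

Section QuotientGroup.
Variables (G : groupType) (H : normal_subgroup G).

Definition coset_rel : rel G := [rel g g' | g^-1 * g' \in H].

Lemma coset_rel_equiv : equiv_class_of coset_rel.
Proof.
split=> [g|g g'|g1 g0 g2]; rewrite /coset_rel /=; first by rewrite mulVg gpred1.
  by rewrite -gpredV invgM invgK.
by move=> h1 h2; have := gpredM _ _ h1 h2; rewrite mulgA mulgK.
Qed.

Canonical coset_equiv_rel := EquivRelPack coset_rel_equiv.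

Definition quotient_group := {eq_quot coset_rel}.
HB.instance Definition _ := EqQuotient.on quotient_group.
HB.instance Definition _ := Choice.on quotient_group.

Definition coset_pi (g : G) : quotient_group := \pi g.

Lemma cosetP g g' : coset_pi g = coset_pi g' <-> g^-1 * g' \in H.
Proof. by split=> [/eqmodP//|gg]; apply/eqmodP. Qed.

Let repr_coset g : exists2 h, h \in H & repr (coset_pi g) = g * h.
Proof.
have /cosetP : coset_pi g = coset_pi (repr (coset_pi g)) by rewrite /coset_pi reprK.
by exists (g^-1 * repr (coset_pi g)) => //; rewrite mulVKg.
Qed.

Let qmul (a b : quotient_group) := coset_pi (repr a * repr b).
Let qinv (a : quotient_group) := coset_pi (repr a)^-1.

Let qmulE g g' : qmul (coset_pi g) (coset_pi g') = coset_pi (g * g').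
Proof.
apply/esym/cosetP; have [h hH ->] := repr_coset g.
have [h' h'H ->] := repr_coset g'.
have -> : (g * g')^-1 * (g * h * (g' * h')) = h ^ g' * h'.
  by rewrite invgM conjgE -!mulgA mulKg.
by rewrite gpredM// normal_subgroupJ.
Qed.

Let qinvE g : qinv (coset_pi g) = coset_pi g^-1.
Proof.
apply/esym/cosetP; have [h hH ->] := repr_coset g.
have -> : g^-1^-1 * (g * h)^-1 = h^-1 ^ g^-1.
  by rewrite invgM conjgE.
by rewrite normal_subgroupJ// gpredV.
Qed.

Let cosetW (P : quotient_group -> Prop) : (forall g, P (coset_pi g)) -> forall a, P a.
Proof. by move=> PH a; rewrite -[a]reprK; exact: PH. Qed.

Let qmulA : associative qmul.
Proof.
by elim/cosetW=> a; elim/cosetW=> b; elim/cosetW=> c; rewrite !qmulE mulgA.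
Qed.
Let qmul1 : left_id (coset_pi 1) qmul.
Proof. by elim/cosetW=> a; rewrite qmulE mul1g. Qed.
Let q1mul : right_id (coset_pi 1) qmul.
Proof. by elim/cosetW=> a; rewrite qmulE mulg1. Qed.
Let qmulV : left_inverse (coset_pi 1) qinv qmul.
Proof. by elim/cosetW=> a; rewrite qinvE qmulE mulVg. Qed.
Let qVmul : right_inverse (coset_pi 1) qinv qmul.
Proof. by elim/cosetW=> a; rewrite qinvE qmulE mulgV. Qed.

HB.instance Definition _ :=
  isGroup.Build quotient_group qmulA qmul1 q1mul qmulV qVmul.

Let coset_morph : {morph coset_pi : g g' / g * g'}.
Proof. by move=> g g'; rewrite -qmulE. Qed.

HB.instance Definition _ :=
  isMultiplicative.Build G quotient_group coset_pi coset_morph.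

End QuotientGroup.

Section OrbitSpace.
Variables (G : groupType) (X : topologicalType) (eta : partial_action G X).

Section Orbit.
Variable H : groupClosed G.

Definition orbit_rel : rel X := [rel x y |
  `[< exists h, [/\ h \in H, pact_dom eta (h, x) & eta (h, x) = y] >]].

Lemma orbit_rel_equiv : equiv_class_of orbit_rel.
Proof.
have sym x y : orbit_rel x y -> orbit_rel y x.
  move=> /asboolP[h [hH hx <-]]; apply/asboolP; exists h^-1.
  by rewrite gpredV; have [] := pact_inv hx.
split=> [x|x y|y x z].
- by apply/asboolP; exists 1; rewrite gpred1; have [] := pact_one eta x.
- by apply/idP/idP; exact: sym.
- move=> /asboolP[h [hH hx <-]] /asboolP[k [kH kx <-]]; apply/asboolP.
  by exists (k * h); have [? ->] := pact_mul hx kx; rewrite gpredM.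
Qed.

Canonical orbit_equiv_rel := EquivRelPack orbit_rel_equiv.

Definition orbit_space := quotient_topology {eq_quot orbit_rel}.
HB.instance Definition _ := Topological.on orbit_space.
HB.instance Definition _ := Quotient.on orbit_space.

Definition orbit_pi (x : X) : orbit_space := \pi x.

Lemma orbit_pi_continuous : continuous orbit_pi.
Proof. exact: pi_continuous. Qed.

Lemma orbit_piP x y : orbit_pi x = orbit_pi y <->
  exists h, [/\ h \in H, pact_dom eta (h, x) & eta (h, x) = y].
Proof. by split=> [/eqmodP/asboolP|?]//; apply/eqmodP/asboolP. Qed.

End Orbit.

(* The map pi_{H1,H2}; defined through representatives, it is meaningful only
   if H1 is contained in H2 (see [orbit_bondE]). *)
Definition orbit_bond (H1 H2 : groupClosed G) (q : orbit_space H1) :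
  orbit_space H2 := orbit_pi H2 (repr q).

Lemma orbit_bondE (H1 H2 : groupClosed G) x : {subset H1 <= H2} ->
  orbit_bond H2 (orbit_pi H1 x) = orbit_pi H2 x.
Proof.
move=> H12; rewrite /orbit_bond.
have /orbit_piP[h [/H12 hH hx hxE]] :
    orbit_pi H1 (repr (orbit_pi H1 x)) = orbit_pi H1 x by rewrite /orbit_pi reprK.
by apply/orbit_piP; exists h.
Qed.

End OrbitSpace.

Section QuotientPartialAction.
Variables (G : groupType) (X : topologicalType) (eta : partial_action G X).
Variable H : normal_subgroup G.
Local Notation Q := (orbit_space eta H).
Local Notation pi := (orbit_pi eta H).

Definition quotient_pact_dom : set (quotient_group H * Q)%type :=
  [set aq | exists g x, aq = (coset_pi H g, pi x) :> quotient_group H * Q /\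
     exists2 h, h \in H & pact_dom eta (h * g, x)].

(* The value pi ((hg).x) at (gH, pi x), with g, x, h chosen arbitrarily; it does
   not depend on this choice (see [quotient_pactE]). Outside of the domain the
   value is the irrelevant default [aq.2]. *)
Definition quotient_pact_fun (aq : quotient_group H * Q) : Q :=
  xget aq.2 [set q | exists g x h, [/\ aq = (coset_pi H g, pi x), h \in H,
    pact_dom eta (h * g, x) & q = pi (eta (h * g, x))]].

Let pact_div a b x : pact_dom eta (a, x) -> pact_dom eta (b, x) ->
  pact_dom eta (b / a, eta (a, x)) /\ eta (b / a, eta (a, x)) = eta (b, x).
Proof.
move=> ax bx; have [a'x a'xE] := pact_inv ax.
have b'x : pact_dom eta (b, eta (a^-1, eta (a, x))) by rewrite a'xE.
by have [? <-] := pact_mul a'x b'x; rewrite a'xE.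
Qed.

Let coset_mull g h : h \in H -> coset_pi H (h * g) = coset_pi H g.
Proof.
move=> hH; apply/esym/cosetP; have -> : g^-1 * (h * g) = h ^ g by [].
exact: normal_subgroupJ.
Qed.

Let coset_mulr g h : h \in H -> coset_pi H (g * h) = coset_pi H g.
Proof. by move=> hH; apply/esym/cosetP; rewrite mulKg. Qed.

Let wd g x g' x' : coset_pi H g = coset_pi H g' -> pi x = pi x' ->
  pact_dom eta (g, x) -> pact_dom eta (g', x') ->
  pi (eta (g, x)) = pi (eta (g', x')).
Proof.
move=> /cosetP nH /orbit_piP[k [kH kx <-]] gx g'x.
have [g'kx ->] := pact_mul kx g'x; have [gg' gg'E] := pact_div gx g'kx.
apply/orbit_piP; exists (g' * k / g); split=> //.
have -> : g' * k / g = (g^-1 * g' * k) ^ g^-1.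
  by rewrite conjgE invgK -!mulgA mulVKg.
by rewrite normal_subgroupJ// gpredM.
Qed.

Lemma quotient_pactE g x h : h \in H -> pact_dom eta (h * g, x) ->
  quotient_pact_fun (coset_pi H g, pi x) = pi (eta (h * g, x)).
Proof.
move=> hH hx; rewrite /quotient_pact_fun; case: xgetP => [q _|].
  move=> [g' [x' [h' [[gg' xx'] h'H hx' ->]]]]; apply/esym/wd => //.
  by rewrite !coset_mull.
by move=> /(_ (pi (eta (h * g, x)))) []; exists g, x, h.
Qed.

Let quotient_pactE1 g x : pact_dom eta (g, x) ->
  quotient_pact_fun (coset_pi H g, pi x) = pi (eta (g, x)).
Proof.
by move=> gx; rewrite (@quotient_pactE g x 1) ?mul1g// gpred1.
Qed.

Let quotient_pact_domP a q : quotient_pact_dom (a, q) ->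
  exists g x, [/\ a = coset_pi H g, q = pi x & pact_dom eta (g, x)].
Proof.
move=> [g [x [[-> ->] [h hH hx]]]]; exists (h * g), x.
by rewrite coset_mull.
Qed.

Let quotient_pact_domI g x :
  pact_dom eta (g, x) -> quotient_pact_dom (coset_pi H g, pi x).
Proof.
by exists g, x; split=> //; exists 1; rewrite ?gpred1// mul1g.
Qed.

Let cosetV g : (coset_pi H g)^-1 = coset_pi H g^-1.
Proof. by rewrite (multiplicativeV (coset_pi H)). Qed.

Let cosetM g g' : coset_pi H g * coset_pi H g' = coset_pi H (g * g').
Proof. by rewrite -gmulfM. Qed.

Let coset1 : 1 = coset_pi H 1.
Proof. by rewrite (multiplicative1 (coset_pi H)). Qed.

Program Definition quotient_pact : partial_action (quotient_group H) Q :=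
  @PartialAction _ _ quotient_pact_dom quotient_pact_fun _ _ _.
Next Obligation.
move=> a q /quotient_pact_domP[g [x [-> -> gx]]].
have [g'x g'xE] := pact_inv gx.
rewrite cosetV quotient_pactE1// quotient_pactE1// g'xE; split=> //.
exact: quotient_pact_domI.
Qed.
Next Obligation.
move=> a b q /quotient_pact_domP[h [x [-> -> hx]]].
rewrite quotient_pactE1// => /quotient_pact_domP[g [y [-> xy gy]]].
have /orbit_piP[k [kH khx ky]] := xy; rewrite -ky in gy.
have [gkhx _] := pact_mul khx gy; have [gkh gkhE] := pact_mul hx gkhx.
rewrite -(coset_mulr g kH) cosetM quotient_pactE1// quotient_pactE1// gkhE.
by split=> //; exact: quotient_pact_domI.
Qed.
Next Obligation.
elim/quotW=> x; have [x1 x1E] := pact_one eta x; rewrite coset1.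
split; first exact: quotient_pact_domI.
by rewrite [LHS]quotient_pactE1// x1E.
Qed.

Definition orbit_pact : partial_action G Q :=
  pullback_pact (coset_pi H) quotient_pact.

End QuotientPartialAction.

Section OrbitSystem.
Context {d : Order.disp_t} {I : preorderType d}.
Variables (G : groupType) (X : topologicalType) (eta : partial_action G X).
Variable H : I -> normal_subgroup G.

Definition orbit_system i j (ij : (i <= j)%O) :
  orbit_space eta (H j) -> orbit_space eta (H i) :=
  @orbit_bond _ _ eta (H j) (H i).

Lemma orbit_systemP :
  (forall i j, (i <= j)%O -> {subset H j <= H i}) ->
  inverse_system (fun i => orbit_space eta (H i)) orbit_system.
Proof.
move=> sH; split=> [i j ij|i ii|i j k ij jk ik].
- apply/quotient_continuous.
  rewrite (_ : _ \o _ = orbit_pi eta (H i)); first exact: orbit_pi_continuous.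
  by apply/funext => x /=; apply: orbit_bondE; exact: sH.
- by elim/quotW=> x; apply: orbit_bondE; exact: sH.
- elim/quotW=> x; rewrite /orbit_system -/(orbit_pi eta (H k) x).
  by rewrite !orbit_bondE //; exact: sH.
Qed.

Definition orbit_limit : set (prod_topology (fun i => orbit_space eta (H i))) :=
  inverse_limit orbit_system.

End OrbitSystem.

Arguments orbit_system {d I G X} eta H i j ij.
Arguments orbit_limit {d I G X} eta H.

(* Main.v *)
Require Import Defs.
From HB Require Import structures.
From mathcomp Require Import all_boot all_order.
From mathcomp Require Import all_classical.
From mathcomp Require Import topology.

(** The orbit maps X -> X/~_{H_i} form a cone over the orbit system, hence
induce a map Phi from X to the limit of the orbit spaces. Everything reduces to
Phi being a homeomorphism ([orbit_cone_homeomorphism]): theta is then eta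
carried along Phi ([transport_pact]), so that Phi is a G-map by construction,
and (ii) says that x |-> pi_j x intertwines eta with the action on X/~_{H_j},
which is the defining formula of the latter at the representative g of its
coset ([orbit_pactE]).

The inverse limit G enters through its kernels: the H_i are closed normal
subgroups, decreasing along the directed set I, with trivial intersection. As G
is compact, they shrink to 1: every neighbourhood of 1 contains some H_i
([small_subgroup]). Two facts about X follow.

- Orbits become small. Continuity of eta at (1, x), where 1.x = x, gives
  neighbourhoods N of 1 and W of x with N.W inside a prescribed neighbourhood
  U of x. With H_i inside N, the H_i-orbits of the points of W stay in U, and
  pi_i(W) is a neighbourhood of pi_i(x) because orbit maps are open
  ([small_orbits]). So every U contains the preimage under Phi of a
  neighbourhood of Phi(x), which makes the inverse of Phi continuous, and also
  Phi injective since X is T1.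

- Orbits are compact. As G*X is closed, the H_i-orbit of x is the image under
  eta of the compact set of the (h, x) in G*X with h in H_i
  ([compact_orbit]). A point of the limit is a decreasing directed family of
  such orbits, and these have a common point ([compact_directed_meet]): Phi is
  surjective. *)

Local Open Scope classical_set_scope.
Local Open Scope group_scope.

(** * Directed intersections and inverse limits *)

(** One compact member suffices: the sets of the family generate a proper filter
that contains it, and a cluster point of this filter lies in each of the closed
sets. *)
Lemma compact_directed_meet (T : topologicalType) (d : Order.disp_t)
    (I : preorderType d) (F : I -> set T) :
  directed I -> (forall i j, (i <= j)%O -> F j `<=` F i) ->
  (forall i, closed (F i)) -> (forall i, F i !=set0) ->
  (exists i, compact (F i)) -> exists x, forall i, F i x.
Proof.
move=> [I0 dirI] Fanti Fcl F0 [i0 Fco].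
have FF : ProperFilter (filter_from [set: I] F).
  apply: filter_from_proper => [|i _]; last exact: F0.
  apply: filter_from_filter => // i j _ _.
  have [k /andP[ik jk]] := dirI i j.
  by exists k => // x Fx; split; [exact: Fanti Fx|exact: Fanti Fx].
have [x [_ clx]] : F i0 `&` cluster (filter_from [set: I] F) !=set0.
  by apply: Fco; exists i0.
by exists x => i; apply: Fcl => B nB; apply: clx => //; exists i.
Qed.

Section InverseLimits.
Context {d : Order.disp_t} {I : preorderType d} (T : I -> topologicalType).
Context (f : forall i j, (i <= j)%O -> T j -> T i).

Lemma inverse_limit_proj_continuous j :
  continuous (@inverse_limit_proj _ _ T f j).
Proof.
move=> x; apply: (@continuous_comp _ (prod_topology T) _ set_val (@proj I T j)).
  exact: initial_continuous.
exact: proj_continuous.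
Qed.

Lemma cone_map_continuous (L : topologicalType) (p : forall i, L -> T i)
    (pC : cone f p) :
  (forall i, continuous (p i)) -> continuous (cone_map pC).
Proof.
move=> cp; apply: continuous_comp_initial => x; apply/cvg_sup => i.
move: x; apply/(@continuousP _ (initial_topology (@^~ i))) => A [B oB <-].
by have /continuousP/(_ _ oB) := cp i.
Qed.

End InverseLimits.

(** * Topological partial actions *)

Section TopologicalPartialActions.
Context {G : groupType} {X : topologicalType}.

Definition pact_preimage (eta : partial_action G X) (g : G) (W : set X) : set X :=
  [set x | pact_dom eta (g, x) /\ W (eta (g, x))].

(** This rids the notion of topological partial action of its homeomorphisms
between subspaces. Forwards, a set relatively open in the open set X_{g^-1} is
open in X. Backwards, W := X gives the openness of the X_g, and the inverse of
eta_g is given by g^-1, so is continuous for the same reason as eta_g. *)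
Lemma topological_pactP (eta : partial_action G X) :
  topological_pact eta <->
  forall g W, open W -> open (pact_preimage eta g W).
Proof.
split=> [topeta g W oW|oeta].
  have [oXg _] := topeta g^-1; have [_ [/continuousP cg _]] := topeta g.
  have [O oO OE] : open (@pact_map _ _ eta g @^-1` (set_val @^-1` W)).
    by apply: cg; exists W.
  rewrite (_ : pact_preimage _ _ _ = pact_set eta g^-1 `&` O); first exact: openI.
  rewrite eqEsubset; split=> x.
    rewrite /pact_preimage/= => -[gx Wgx].
    have gx' : pact_set eta g^-1 x by rewrite /pact_set/= invgK.
    split=> //; suff : (set_val @^-1` O) (exist _ x (mem_set gx')) by [].
    by rewrite OE.
  move=> [gx Ox]; suff : (set_val @^-1` O) (exist _ x (mem_set gx)).
    by rewrite OE /= => Wgx; move/set_mem: (mem_set gx); rewrite {1}/pact_set/= invgK.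
  exact: Ox.
(* The group element h is kept apart from the index g of the domain so that this
   applies both to eta_g, defined on the points where (g^-1)^-1 acts, and to its
   inverse, without a cast along invgK. *)
have cont (g k : G) (f : pact_set eta g -> pact_set eta k) (h : G) :
    (forall x : pact_set eta g, pact_dom eta (h, val x)) ->
    (forall x, val (f x) = eta (h, val x)) -> continuous f.
  move=> hdom fE; apply: continuous_comp_initial; apply/continuousP => W oW.
  exists (pact_preimage eta h W); first exact: oeta.
  apply/seteqP; split=> x; rewrite /pact_preimage/=.
    by move=> [_]; rewrite -fE.
  by move=> Wx; split; [exact: hdom|rewrite -fE].
move=> g; split.
  rewrite (_ : pact_set eta g = pact_preimage eta g^-1 setT).
    exact/oeta/openT.
  by apply/seteqP; split=> [x //|x [//]].
have domg (x : pact_set eta g^-1) : pact_dom eta (g, val x).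
  by case: x => x /= /set_mem; rewrite /pact_set/= invgK.
have domg' (y : pact_set eta g) : pact_dom eta (g^-1, val y).
  by case: y => y /= /set_mem.
have inv_in (y : pact_set eta g) : eta (g^-1, val y) \in pact_set eta g^-1.
  by apply/mem_set; exact: (pact_inv (domg' y)).1.
split; first exact: (@cont _ _ _ g).
exists (fun y : pact_set eta g =>
  exist _ (eta (g^-1, val y)) (inv_in y) : pact_set eta g^-1); split.
- by move=> x; apply/val_inj => /=; have [] := pact_inv (domg x).
- move=> y; apply/val_inj => /=.
  by have [] := pact_inv (domg' y); rewrite invgK.
- exact: (@cont _ _ _ g^-1).
Qed.

End TopologicalPartialActions.

Section Transport.
Context {G : groupType} {X Y : topologicalType} (eta : partial_action G X).
Context {phi : X -> Y} {psi : Y -> X} (phiK : cancel phi psi) (psiK : cancel psi phi).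

Program Definition transport_pact : partial_action G Y :=
  @PartialAction G Y [set gy | pact_dom eta (gy.1, psi gy.2)]
    (fun gy => phi (eta (gy.1, psi gy.2))) _ _ _.
Next Obligation.
by move=> g y /= gy; rewrite phiK; have [? ->] := pact_inv gy; rewrite psiK.
Qed.
Next Obligation.
move=> g h y /= hy; rewrite phiK => ghy.
by have [? ->] := pact_mul hy ghy.
Qed.
Next Obligation.
by move=> y /=; have [? ->] := pact_one eta (psi y); rewrite psiK.
Qed.

Lemma transport_pactE g x : transport_pact (g, phi x) = phi (eta (g, x)).
Proof. by rewrite /= phiK. Qed.

Lemma transport_pact_topological :
  continuous phi -> continuous psi ->
  topological_pact eta -> topological_pact transport_pact.
Proof.
move=> /continuousP cphi /continuousP cpsi /topological_pactP oeta.
apply/topological_pactP => g W /cphi /(oeta g) /cpsi.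
exact.
Qed.

End Transport.

(** * Orbit maps *)

Section OrbitMap.
Context {G : groupType} {X : topologicalType} (eta : partial_action G X).

(** The saturation of W is the union over h in H of the sets of points that h
moves into W. *)
Lemma orbit_pi_open (H : groupClosed G) (W : set X) :
  topological_pact eta -> open W -> open (orbit_pi eta H @` W).
Proof.
move=> topeta oW; rewrite (_ : open _ =
  open (orbit_pi eta H @^-1` (orbit_pi eta H @` W))) //.
rewrite (_ : _ @^-1` _ = \bigcup_(h in [set h | h \in H]) pact_preimage eta h W).
  by apply: bigcup_open => h _; move/topological_pactP: topeta; exact.
apply/seteqP; split=> [x [y Wy /esym/orbit_piP[h [hH hx hxy]]]|x [h /= hH [hx Wx]]].
  by exists h => //; split=> //; rewrite hxy.
by exists (eta (h, x)) => //; apply/esym/orbit_piP; exists h.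
Qed.

Lemma orbit_pactE (H : normal_subgroup G) g x : pact_dom eta (g, x) ->
  pact_dom (orbit_pact eta H) (g, orbit_pi eta H x) /\
  orbit_pact eta H (g, orbit_pi eta H x) = orbit_pi eta H (eta (g, x)).
Proof.
move=> gx; have gx1 : pact_dom eta (1 * g, x) by rewrite mul1g.
split; first by exists g, x; split=> //; exists 1; rewrite ?gpred1.
by rewrite /= (@quotient_pactE _ _ _ _ _ _ 1) ?gpred1// mul1g.
Qed.

End OrbitMap.

(** * The limit of the orbit spaces *)

Section OrbitLimit.
Context {d : Order.disp_t} {I : preorderType d}.
Context {G : topologicalGroupType} {X : topologicalType}.
Context (eta : partial_action G X) (H : I -> normal_subgroup G).
Hypotheses (Gco : compact [set: G]) (dirI : directed I).
Hypothesis Hanti : forall i j, (i <= j)%O -> {subset H j <= H i}.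
Hypothesis Hcl : forall i, closed [set g | g \in H i].
Hypothesis Htriv : forall g, (forall i, g \in H i) -> g = 1.

(** Otherwise the compact sets H_i minus the interior of N are all nonempty, and
a common point of them is at once equal to 1 and outside of the interior of N. *)
Lemma small_subgroup (N : set G) :
  nbhs 1 N -> exists i, [set g | g \in H i] `<=` N.
Proof.
have Dcl i : closed ([set g | g \in H i] `\` N°).
  by rewrite setDE; apply: closedI => //; apply/open_closedC/open_interior.
move=> N1; apply/not_existsP => HN.
have [||||g Hg] := @compact_directed_meet G _ I
  (fun i => [set g | g \in H i] `\` N°) dirI.
- by move=> i j ij g [gH gN]; split=> //; exact: Hanti ij _ gH.
- by [].
- move=> i; apply/set0P/eqP; rewrite setD_eq0 => HiN.
  by apply: (HN i); apply: subset_trans HiN _; exact: interior_subset.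
- have [i _] := dirI.1; exists i.
  exact: subclosed_compact Gco _.
have g1 : g = 1 by apply: Htriv => i; have [] := Hg i.
by have [i _] := dirI.1; have [_] := Hg i; rewrite g1; apply.
Qed.

Hypotheses (topeta : topological_pact eta) (ceta : continuous_pact eta).

(** The sets pi_i^-1(V), for i in I and V open in X/~_{H_i}, form a base of the
topology of X: this is the local form of the claim that Phi is an embedding. *)
Lemma small_orbits (x : X) (U : set X) : nbhs x U ->
  exists i, exists2 V, nbhs (orbit_pi eta (H i) x) V &
    orbit_pi eta (H i) @^-1` V `<=` U.
Proof.
move=> Ux; have [dom1 e1] := pact_one eta x.
have /subspace_continuousP/(_ _ dom1) := ceta.
have xE : nbhs (eta (1, x)) U by rewrite e1.
move=> /(_ _ xE)[[N W] [/= N1 Wx] NWU].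
have [i HN] := small_subgroup _ N1.
exists i, (orbit_pi eta (H i) @` W°).
  apply: open_nbhs_nbhs; split; last by exists x.
  by apply: orbit_pi_open => //; exact: open_interior.
move=> y [z /interior_subset Wz /orbit_piP[h [/HN Nh hz <-]]].
by apply: (NWU (h, z)).
Qed.

Hypothesis Xhaus : hausdorff_space X.
Hypothesis domcl : closed (pact_dom eta).

(** The H_i-orbit of x is the image under eta of a closed subset of the compact
set H_i x {x}. *)
Lemma compact_orbit i (x : X) :
  compact [set y | orbit_pi eta (H i) y = orbit_pi eta (H i) x].
Proof.
rewrite (_ : mkset _ = eta @` (([set g | g \in H i] `*` [set x]) `&` pact_dom eta)).
  apply: continuous_compact.
    by apply: continuous_subspaceW ceta => ? [].
  apply: compact_closedI => //; apply: compact_setX; last exact: compact_set1.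
  exact: subclosed_compact Gco _.
apply/seteqP; split=> y /=.
  by move=> /esym/orbit_piP[h [hH hx <-]]; exists (h, x).
by move=> [[h z] /= [[hH ->] hx] <-]; apply/esym/orbit_piP; exists h.
Qed.

Lemma orbit_cone : cone (orbit_system eta H) (fun i => orbit_pi eta (H i)).
Proof. by move=> i j ij x; apply: orbit_bondE; exact: Hanti. Qed.

Lemma orbit_cone_homeomorphism : homeomorphism (cone_map orbit_cone).
Proof.
set Phi := cone_map orbit_cone.
(* If Phi x = Phi y with x != y, then y lies in every pi_i^-1(V) with V around
   pi_i x, in particular in one that avoids y. *)
have Phi_inj : injective Phi.
  move=> x y /(congr1 val)/= xy; apply: contrapT => nxy.
  have Uy : nbhs x (~` [set y]).
    apply: open_nbhs_nbhs; split=> //; apply/closed_openC.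
    exact: accessible_closed_set1 (hausdorff_accessible Xhaus) _.
  have [i [V Vx VU]] := small_orbits _ _ Uy.
  apply: (VU y) => //=.
  rewrite -[orbit_pi _ _ y]/((fun i => orbit_pi eta (H i) y) i).
  by rewrite -xy; exact: nbhs_singleton.
(* A preimage of q is a common point of the orbits q_i seen as subsets of X. *)
have Phi_surj q : exists x, Phi x = q.
  have [||||x qx] := @compact_directed_meet X _ I
    (fun i => [set x | orbit_pi eta (H i) x = val q i]) dirI.
  - move=> i j ij x /= xE; case: q xE => q /= /set_mem qlim xE.
    by rewrite -(qlim _ _ ij) -xE; apply/esym/orbit_cone.
  - move=> i; rewrite -[val q i]reprK; apply: compact_closed => //.
    exact: compact_orbit.
  - by move=> i; exists (repr (val q i)); rewrite /= /orbit_pi reprK.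
  - have [i _] := dirI.1; exists i; rewrite -[val q i]reprK.
    exact: compact_orbit.
  by exists x; apply/val_inj/functional_extensionality_dep => i; exact: qx.
have [Psi PsiK] := choice Phi_surj.
split.
  by apply: cone_map_continuous => i; exact: orbit_pi_continuous.
exists Psi; split=> //; first by move=> x; apply: Phi_inj; rewrite PsiK.
move=> q U /(small_orbits _ _)[i [V Vx VU]].
rewrite -[_ U]/(nbhs q (Psi @^-1` U)).
have : nbhs q (inverse_limit_proj i @^-1` V).
  apply: inverse_limit_proj_continuous; rewrite -{1}(PsiK q); exact: Vx.
by apply: filterS => r /= Vr; apply: VU => /=; rewrite -(PsiK r) in Vr.
Qed.

End OrbitLimit.

Lemma ker_closed (G K : topologicalGroupType) (f : {multiplicative G -> K}) :
  continuous f -> hausdorff_space K -> closed [set g | g \in hom_ker f].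
Proof.
move=> cf Khaus; rewrite (_ : mkset _ = f @^-1` [set 1]).
  apply: closed_comp => [g _|]; first exact: cf.
  exact: accessible_closed_set1 (hausdorff_accessible Khaus) _.
by apply/seteqP; split=> g /eqP.
Qed.

Theorem proposition4p9 (d : Order.disp_t) (I : preorderType d)
    (G : topologicalGroupType) (Gs : I -> topologicalGroupType)
    (pb : forall i j : I, (i <= j)%O -> {multiplicative Gs j -> Gs i})
    (p : forall i : I, {multiplicative G -> Gs i})
    (X : topologicalType) (eta : partial_action G X) :
  compact [set: G] -> hausdorff_space G ->
  directed I ->
  (forall i, hausdorff_space (Gs i)) ->
  inverse_system Gs (fun i j ij => pb i j ij) ->
  is_inverse_limit Gs (fun i j ij => pb i j ij) G (fun i => p i) ->
  hausdorff_space X ->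
  topological_pact eta -> continuous_pact eta ->
  closed (pact_dom eta) ->
  let H := fun i => hom_ker (p i) in
  exists theta : partial_action G (orbit_limit eta H),
    [/\ topological_pact theta,
        G_equivalent eta theta &
        forall (j : I) (gx : G * orbit_limit eta H), pact_dom theta gx ->
          pact_dom (orbit_pact eta (H j)) (gx.1, inverse_limit_proj j gx.2) /\
          inverse_limit_proj j (theta gx) =
            orbit_pact eta (H j) (gx.1, inverse_limit_proj j gx.2)].
Proof.
move=> Gco _ dirI Gshaus _ [pC [cp [r [rK _ _]]]] Xhaus topeta ceta domcl H.
have Hcl i : closed [set g | g \in H i].
  apply: ker_closed => //.
  move=> g; apply: (@continuous_comp _ _ _ (cone_map pC) (inverse_limit_proj i)).
    exact: cp.
  exact: inverse_limit_proj_continuous.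
have Hanti i j : (i <= j)%O -> {subset H j <= H i}.
  by move=> ij g /eqP gj; apply/eqP; rewrite -(pC _ _ ij) gj multiplicative1.
(* An element of all the kernels has the same coordinates as 1, and the map from
   G to the limit of the G_i is injective. *)
have Htriv g : (forall i, g \in H i) -> g = 1.
  move=> Hg; apply: (can_inj rK); apply/val_inj => /=.
  apply/functional_extensionality_dep => i.
  by rewrite multiplicative1; exact/eqP/Hg.
have Phi_homeo := @orbit_cone_homeomorphism _ _ _ _ eta H Gco dirI Hanti Hcl
  Htriv topeta ceta Xhaus domcl.
have [cPhi [Psi [PhiK PsiK cPsi]]] := Phi_homeo.
exists (transport_pact eta PhiK PsiK); split.
- exact: transport_pact_topological.
- exists (cone_map (@orbit_cone _ _ _ _ eta H Hanti)) => // g x gx.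
  by rewrite transport_pactE; split; rewrite //= PhiK.
move=> j [g q] /= gx.
have qE : inverse_limit_proj j q = orbit_pi eta (H j) (Psi q).
  by rewrite -{1}(PsiK q).
have [gq gqE] := orbit_pactE eta (H j) _ _ gx.
by rewrite qE.
Qed.
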